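(* Let $p,q\ge 0$ and $n=p+q$. The restriction of $\rho\colon \Gamma_{p,q}\to \mathbf{GL}(n)$ to the pinor group $\mathbf{Pin}(p,q)$ is a surjective homomorphism $\rho\colon \mathbf{Pin}(p,q)\to \mathbf{O}(p,q)$ whose kernel is $\{-1,1\}$, and the restriction of $\rho$ to the spinor group $\mathbf{Spin}(p,q)$ is a surjective homomorphism $\rho\colon \mathbf{Spin}(p,q)\to \mathbf{SO}(p,q)$ whose kernel is $\{-1,1\}$.
   Context: Let $n=p+q$ and $\Phi_{p,q}(x_1,\dots,x_{p+q})=x_1^2+\cdots+x_p^2-(x_{p+1}^2+\cdots+x_{p+q}^2)$ on $\mathbb{R}^n$. $\mathbf{O}(p,q)$ is the group of linear maps $f$ of $\mathbb{R}^n$ with $\Phi_{p,q}(f(v))=\Phi_{p,q}(v)$ for all $v$, and $\mathbf{SO}(p,q)$ is its subgroup of maps with determinant $1$. The Clifford algebra $\mathrm{Cl}_{p,q}$ is the real unital associative algebra $T(\mathbb{R}^n)/\mathfrak{A}$, where $T(\mathbb{R}^n)$ is the tensor algebra and $\mathfrak{A}$ is the two-sided ideal generated by all $v\otimes v-\Phi_{p,q}(v)\cdot 1$ (so $v^2=\Phi_{p,q}(v)\cdot 1$). The canonical map $\mathbb{R}^n\to\mathrm{Cl}_{p,q}$ is injective and $\mathbb{R}^n$ is identified with its image. $t$ is the unique anti-automorphism of $\mathrm{Cl}_{p,q}$ that is the identity on $\mathbb{R}^n$; $\alpha$ is the unique algebra automorphism with $\alpha(v)=-v$ for $v\in\mathbb{R}^n$;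 $\overline{x}=t(\alpha(x))$; $N(x)=x\overline{x}$. $\mathrm{Cl}_{p,q}^0=\{x\in\mathrm{Cl}_{p,q}\mid \alpha(x)=x\}$. The Clifford group is $\Gamma_{p,q}=\{x\in\mathrm{Cl}_{p,q}^*\mid \alpha(x)vx^{-1}\in\mathbb{R}^n\text{ for all }v\in\mathbb{R}^n\}$, where $\mathrm{Cl}_{p,q}^*$ is the group of units, and $\Gamma_{p,q}^+=\Gamma_{p,q}\cap\mathrm{Cl}_{p,q}^0$. For $x\in\Gamma_{p,q}$, $\rho(x)$ is the linear map $v\mapsto\alpha(x)vx^{-1}$ of $\mathbb{R}^n$. $\mathbf{Pin}(p,q)=\{x\in\Gamma_{p,q}\mid N(x)=\pm 1\}$ and $\mathbf{Spin}(p,q)=\mathbf{Pin}(p,q)\cap\Gamma_{p,q}^+$. *)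

(* Defs.v *)
From HB Require Import structures.
From mathcomp Require Import all_boot all_order all_algebra.
From mathcomp Require Import boolp classical_sets functions reals.
From mathcomp.multinomials Require Import monalg.
From mathcomp Require Import ring.

Set Implicit Arguments.
Unset Strict Implicit.
Unset Printing Implicit Defensive.

Import GRing.Theory Num.Theory.

Local Open Scope classical_set_scope.
Local Open Scope quotient_scope.
Local Open Scope ring_scope.

(* The tensor algebra T(R^n) in the standard basis e_0, ..., e_(n-1): the        *)
(* tensors e_(i_1) (x) ... (x) e_(i_k) form a basis of the k-th tensor power, so *)
(* an element of T(R^n) is a finitely supported family of scalars indexed by the *)
(* words i_1 ... i_k over 'I_n, and the tensor product is concatenation of       *)
(* words.  The lemmas tensor_lift_vec and tensor_ext are its universal property. *)
Definition tensor_algebra (R : realType) (n : nat) : Type :=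
  {malg R[{fmonom 'I_n}]}.

Section TensorAlgebra.
Context (R : realType) (n : nat).
Local Notation T := (tensor_algebra R n).

HB.instance Definition _ := GRing.Lalgebra.on T.

Fact tensor_scalerAr (a : R) (x y : T) : a *: (x * y) = x * (a *: y).
Proof.
have scC (c : R) (z : T) : z * (c%:MP : {malg R[{fmonom 'I_n}]}) = c *: z.
  rewrite malgM_def fgmulgU malgZ_def /fgscale.
  by apply: eq_bigr => k _; rewrite mulm1 mulrC.
by rewrite -!scC mulrA.
Qed.
HB.instance Definition _ := GRing.Lalgebra_isAlgebra.Build R T tensor_scalerAr.

Definition tensor_vec (v : 'cV[R]_n) : T := \sum_i << v i 0 *g fmu i >>.

Fact tensor_vec_linear : linear tensor_vec.
Proof.
move=> a u v; rewrite /tensor_vec scaler_sumr -big_split /=.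
apply: eq_bigr => i _; rewrite !mxE monalgUD; congr (_ + _).
by rewrite -mul_malgC malgM_def fgmulUU mul1m.
Qed.
HB.instance Definition _ :=
  GRing.isLinear.Build R 'cV[R]_n T _ tensor_vec tensor_vec_linear.

Section Lift.
Context (A : algType R) (f : {linear 'cV[R]_n -> A}).

Let word (w : {fmonom 'I_n}) : A := \prod_(i <- w) f (delta_mx i 0).

Fact tensor_word_mmorphism : mmorphism word.
Proof.
by split=> [u v|]; rewrite /word ?fmM ?big_cat // fm1 big_nil.
Qed.
HB.instance Definition _ :=
  isMultiplicative.Build {fmonom 'I_n} A word tensor_word_mmorphism.

Definition tensor_lift (x : T) : A := mmap (in_alg A) word x.

Fact tensor_lift_zmod : zmod_morphism tensor_lift.
Proof. exact: (@mmap_is_additive _ _ _ (in_alg A) word). Qed.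

Fact tensor_lift_monoid : monoid_morphism tensor_lift.
Proof.
have [] := @commr_mmap_is_multiplicative _ _ _ (in_alg A) word.
  by move=> g m m'; rewrite /GRing.comm /= mulr_algl mulr_algr.
by move=> fM f1; split.
Qed.

Fact tensor_lift_scalable : scalable tensor_lift.
Proof.
move=> a x; rewrite /tensor_lift.
by rewrite (@mmapZ _ _ _ (in_alg A) word) /= mulr_algl.
Qed.

HB.instance Definition _ :=
  GRing.isZmodMorphism.Build T A tensor_lift tensor_lift_zmod.
HB.instance Definition _ :=
  GRing.isMonoidMorphism.Build T A tensor_lift tensor_lift_monoid.
HB.instance Definition _ :=
  GRing.isScalable.Build R T A _ tensor_lift tensor_lift_scalable.

Lemma col_sum_delta (v : 'cV[R]_n) : v = \sum_i v i 0 *: delta_mx i 0.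
Proof.
rewrite {1}[v]matrix_sum_delta; apply: eq_bigr => i _.
by rewrite big_ord1.
Qed.

Lemma tensor_lift_vec (v : 'cV[R]_n) : tensor_lift (tensor_vec v) = f v.
Proof.
rewrite [in RHS](col_sum_delta v) !linear_sum /=; apply: eq_bigr => i _.
rewrite linearZ /= /tensor_lift (@mmapU _ _ _ (in_alg A) word) /=.
by rewrite /word fmU big_seq1 mulr_algl.
Qed.

End Lift.

Lemma tensor_ext (A : algType R) (f g : {lrmorphism T -> A}) :
  (forall v, f (tensor_vec v) = g (tensor_vec v)) -> f =1 g.
Proof.
move=> fg x; rewrite [x : {malg R[_]}]monalgE !linear_sum /=.
apply: eq_bigr => w _; move: (x@_w) => c.
have -> : << c *g w >> = c *: \prod_(i <- w) tensor_vec (delta_mx i 0) :> T.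
  have vecE i : tensor_vec (delta_mx i 0) = << fmu i >>.
    rewrite /tensor_vec (bigD1 i) //= big1 => [|j ji]; rewrite !mxE eqxx.
      by rewrite eqxx addr0.
    by rewrite (negbTE ji) monalgU0.
  rewrite -mul_malgC.
  have -> : \prod_(i <- w) tensor_vec (delta_mx i 0) = << w >> :> T.
    case: w => w; elim: w => [|i w IHw].
      by rewrite big_nil -fmoneE.
    rewrite big_cons IHw vecE malgM_def fgmulUU mulr1; congr << _ *g _ >>.
    by apply/eqP; rewrite fmP fmM fmU.
  by rewrite malgM_def fgmulUU mulr1 mul1m.
rewrite !linearZ !rmorph_prod /=; congr (_ *: _).
by apply: eq_bigr => i _.
Qed.

End TensorAlgebra.

Definition two_sided_ideal (A : pzRingType) (I : set A) : Prop :=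
  [/\ I 0, forall x y, I x -> I y -> I (x + y)
         & forall a x b, I x -> I (a * x * b)].

Section CliffordAlgebra.
Context (R : realType) (p q : nat).
Local Notation V := 'cV[R]_(p + q).
Local Notation T := (tensor_algebra R (p + q)).

Definition Phi (v : V) : R :=
  \sum_(i < p) v (lshift q i) 0 ^+ 2 - \sum_(j < q) v (rshift p j) 0 ^+ 2.

Definition clifford_ideal : set T :=
  smallest (@two_sided_ideal T)
    [set tensor_vec v * tensor_vec v - (Phi v)%:A | v in [set: V]].

Fact clifford_ideal_ideal : two_sided_ideal clifford_ideal.
Proof.
split=> [I [[]]//|x y xI yI I HI|a x b xI I HI].
- by have [[_ ID _] _] := HI; apply: ID; [apply: xI|apply: yI].
- by have [[_ _ IM] _] := HI; apply: IM; apply: xI.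
Qed.

Fact clifford_ideal0 : clifford_ideal 0.
Proof. by case: clifford_ideal_ideal. Qed.

Fact clifford_idealD x y :
  clifford_ideal x -> clifford_ideal y -> clifford_ideal (x + y).
Proof. by case: clifford_ideal_ideal => _ ID _; apply: ID. Qed.

Fact clifford_idealM a x b : clifford_ideal x -> clifford_ideal (a * x * b).
Proof. by case: clifford_ideal_ideal => _ _; apply. Qed.

Fact clifford_idealN x : clifford_ideal x -> clifford_ideal (- x).
Proof. by move=> /(clifford_idealM (-1) 1); rewrite mulr1 mulN1r. Qed.

Definition clifford_eqv (x y : T) : bool := `[< clifford_ideal (x - y) >].

Fact clifford_eqv_class : equiv_class_of clifford_eqv.
Proof.
split=> [x|x y|y x z].
- by apply/asboolP; rewrite subrr; exact: clifford_ideal0.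
- by apply/asboolP/asboolP => /clifford_idealN; rewrite opprB.
- move=> /asboolP xy /asboolP yz; apply/asboolP.
  by have := clifford_idealD xy yz; rewrite subrKA.
Qed.
Canonical clifford_eqv_equiv := EquivRelPack clifford_eqv_class.
Canonical clifford_eqv_encModRel := defaultEncModRel clifford_eqv.

Definition clifford : Type := {eq_quot clifford_eqv}.
HB.instance Definition _ := Choice.on clifford.
HB.instance Definition _ := EqQuotient.on clifford.

End CliffordAlgebra.

(* The quotient map and the operations are locked because unfolding them down to *)
(* representatives makes conversion explode.                                     *)
HB.lock Definition clifford_pi (R : realType) (p q : nat)
  (x : tensor_algebra R (p + q)) : clifford R p q := \pi_(clifford R p q) x.
HB.lock Definition clifford_add (R : realType) (p q : nat)
  (x y : clifford R p q) : clifford R p q := clifford_pi (repr x + repr y).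
HB.lock Definition clifford_opp (R : realType) (p q : nat)
  (x : clifford R p q) : clifford R p q := clifford_pi (- repr x).
HB.lock Definition clifford_mul (R : realType) (p q : nat)
  (x y : clifford R p q) : clifford R p q := clifford_pi (repr x * repr y).
HB.lock Definition clifford_scale (R : realType) (p q : nat)
  (a : R) (x : clifford R p q) : clifford R p q := clifford_pi (a *: repr x).
HB.lock Definition clifford_lift (R : realType) (p q : nat) (A : algType R)
  (f : {linear 'cV[R]_(p + q) -> A}) (x : clifford R p q) : A :=
  tensor_lift f (repr x).

Section CliffordRing.
Context (R : realType) (p q : nat).
Local Notation V := 'cV[R]_(p + q).
Local Notation T := (tensor_algebra R (p + q)).
Local Notation clifford := (clifford R p q).
Local Notation clifford_ideal := (@clifford_ideal R p q).
Local Notation pi := (@clifford_pi R p q).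
Local Notation clifford_pi := (@clifford_pi R p q).
Local Notation clifford_add := (@clifford_add R p q).
Local Notation clifford_opp := (@clifford_opp R p q).
Local Notation clifford_mul := (@clifford_mul R p q).
Local Notation clifford_scale := (@clifford_scale R p q).

Fact clifford_piP x y :
  clifford_pi x = clifford_pi y <-> clifford_ideal (x - y).
Proof.
rewrite clifford_pi.unlock; split => [/eqmodP/asboolP //|xy].
by apply/eqmodP/asboolP.
Qed.

Fact clifford_pi_repr x : clifford_pi (repr x) = x.
Proof. by rewrite clifford_pi.unlock; exact: reprK. Qed.

Fact clifford_addE x y : clifford_add (pi x) (pi y) = pi (x + y).
Proof.
rewrite clifford_add.unlock; apply/clifford_piP.
have /clifford_piP hx := clifford_pi_repr (pi x).
have /clifford_piP hy := clifford_pi_repr (pi y).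
by have := clifford_idealD hx hy; rewrite opprD addrACA.
Qed.

Fact clifford_oppE x : clifford_opp (pi x) = pi (- x).
Proof.
rewrite clifford_opp.unlock; apply/clifford_piP.
have /clifford_piP hx := clifford_pi_repr (pi x).
by have := clifford_idealN hx; rewrite opprD.
Qed.

Fact clifford_mulE x y : clifford_mul (pi x) (pi y) = pi (x * y).
Proof.
rewrite clifford_mul.unlock; apply/clifford_piP.
have /clifford_piP hx := clifford_pi_repr (pi x).
have /clifford_piP hy := clifford_pi_repr (pi y).
have := clifford_idealD (clifford_idealM 1 (repr (pi y)) hx)
                        (clifford_idealM x 1 hy).
by rewrite mul1r mulr1 mulrBl mulrBr subrKA.
Qed.

Fact clifford_scaleE a x : clifford_scale a (pi x) = pi (a *: x).
Proof.
rewrite clifford_scale.unlock; apply/clifford_piP.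
have /clifford_piP hx := clifford_pi_repr (pi x).
have := clifford_idealM a%:A 1 hx.
by rewrite mulr1 mulr_algl scalerBr.
Qed.

Fact clifford_pi_surj (P : clifford -> Prop) :
  (forall x, P (pi x)) -> forall x, P x.
Proof. by move=> Ppi x; rewrite -[x]clifford_pi_repr; apply: Ppi. Qed.

Fact clifford_addA : associative clifford_add.
Proof.
elim/clifford_pi_surj => x; elim/clifford_pi_surj => y.
by elim/clifford_pi_surj => z; rewrite !clifford_addE addrA.
Qed.

Fact clifford_addC : commutative clifford_add.
Proof.
elim/clifford_pi_surj => x; elim/clifford_pi_surj => y.
by rewrite !clifford_addE addrC.
Qed.

Fact clifford_add0 : left_id (pi 0) clifford_add.
Proof. by elim/clifford_pi_surj => x; rewrite clifford_addE add0r. Qed.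

Fact clifford_addN : left_inverse (pi 0) clifford_opp clifford_add.
Proof.
by elim/clifford_pi_surj => x; rewrite clifford_oppE clifford_addE addNr.
Qed.

HB.instance Definition _ := GRing.isZmodule.Build clifford
  clifford_addA clifford_addC clifford_add0 clifford_addN.

Fact clifford_pi_zmod : zmod_morphism clifford_pi.
Proof.
move=> x y; rewrite -[RHS]/(clifford_add _ (clifford_opp _)).
by rewrite clifford_oppE clifford_addE.
Qed.
HB.instance Definition _ :=
  GRing.isZmodMorphism.Build T clifford clifford_pi clifford_pi_zmod.

Fact clifford_mulA : associative clifford_mul.
Proof.
elim/clifford_pi_surj => x; elim/clifford_pi_surj => y.
by elim/clifford_pi_surj => z; rewrite !clifford_mulE mulrA.
Qed.

Fact clifford_mul1 : left_id (pi 1) clifford_mul.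
Proof. by elim/clifford_pi_surj => x; rewrite clifford_mulE mul1r. Qed.

Fact clifford_mulr1 : right_id (pi 1) clifford_mul.
Proof. by elim/clifford_pi_surj => x; rewrite clifford_mulE mulr1. Qed.

Fact clifford_mulDl : left_distributive clifford_mul +%R.
Proof.
elim/clifford_pi_surj => x; elim/clifford_pi_surj => y.
elim/clifford_pi_surj => z.
by rewrite -raddfD !clifford_mulE -raddfD /= mulrDl.
Qed.

Fact clifford_mulDr : right_distributive clifford_mul +%R.
Proof.
elim/clifford_pi_surj => x; elim/clifford_pi_surj => y.
elim/clifford_pi_surj => z.
by rewrite -raddfD !clifford_mulE -raddfD /= mulrDr.
Qed.

Lemma clifford_ideal_sub (A : algType R) (f : {linear V -> A}) :
  (forall v, f v * f v = (Phi v)%:A) ->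
  forall x, clifford_ideal x -> tensor_lift f x = 0.
Proof.
move=> ff x /(_ [set y | tensor_lift f y = 0]); apply.
split; first split; rewrite /= ?raddf0 //.
- by move=> u v fu fv; rewrite raddfD /= fu fv addr0.
- by move=> a u b fu; rewrite !rmorphM /= fu mulr0 mul0r.
- move=> _ [v _ <-] /=; rewrite rmorphB rmorphM /= !tensor_lift_vec ff.
  by rewrite linearZ rmorph1 subrr.
Qed.

Definition signature (i : nat) : R := if (i < p)%N then 1 else -1.

Lemma PhiE (v : V) : Phi v = \sum_(i < p + q) signature i * v i 0 ^+ 2.
Proof.
rewrite big_split_ord /= /Phi -sumrN; congr (_ + _); apply: eq_bigr => i _.
  by rewrite /signature ltn_ord mul1r.
by rewrite /signature ltnNge leq_addr mulN1r.
Qed.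

(* Gamma matrices: a concrete algebra in which Phi is a square, showing that the *)
(* Clifford ideal is proper.                                                     *)
Lemma gamma_matrices (s : nat -> R) (n : nat) :
  exists (m : nat) (E : nat -> 'M[R]_m), (0 < m)%N /\
    forall i j, (i < n)%N -> (j < n)%N ->
    E i *m E j + E j *m E i = ((s i *+ 2) *+ (i == j))%:M.
Proof.
elim: n => [|n [m [E [m_gt0 HE]]]]; first by exists 1%N, (fun=> 0).
pose D i : 'M[R]_(m + m) := block_mx (E i) 0 0 (- E i).
pose F : 'M[R]_(m + m) := block_mx 0 (s n)%:M 1%:M 0.
exists (m + m)%N, (fun i => if (i < n)%N then D i else F).
split=> [|i j]; first by rewrite addn_gt0 m_gt0.
have DF k : D k *m F + F *m D k = 0.
  rewrite /D /F !mulmx_block add_block_mx !(mul0mx, mulmx0, mul1mx, mulmx1).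
  rewrite !(addr0, add0r) mul_scalar_mx mul_mx_scalar scalerN.
  by rewrite subrr addNr; apply/eqP; rewrite block_mx_eq0 !eqxx.
rewrite /= !ltnS; have [jn|jn] := ltnP j n; have [in_|in_] := ltnP i n.
- move=> _ _; rewrite /D !mulmx_block add_block_mx.
  rewrite !(mul0mx, mulmx0, mulNmx, mulmxN, opprK) !(addr0, add0r) HE //.
  by rewrite [RHS]scalar_mx_block.
- move=> ilen _; have -> : (i == j) = false by apply/gtn_eqF/(leq_trans jn).
  by rewrite addrC DF mulr0n raddf0.
- move=> _ jlen; have -> : (i == j) = false by apply/ltn_eqF/(leq_trans in_).
  by rewrite DF mulr0n raddf0.
- move=> ilen jlen; have -> : i = n by apply/eqP; rewrite eqn_leq ilen.
  have -> : j = n by apply/eqP; rewrite eqn_leq jlen.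
  rewrite eqxx mulr1n /F mulmx_block add_block_mx.
  rewrite !(mul0mx, mulmx0, mul1mx, mulmx1) !(addr0, add0r) -raddfD -mulr2n.
  by rewrite [RHS]scalar_mx_block.
Qed.

Fact clifford_ideal_proper : ~ clifford_ideal 1.
Proof.
have [[|m] [E [//= _ HE]]] := gamma_matrices signature (p + q).
pose f (v : V) : 'M[R]_m.+1 := \sum_i v i 0 *: E i.
have f_lin : linear f.
  move=> a u v; rewrite /f scaler_sumr -big_split /=; apply: eq_bigr => i _.
  by rewrite !mxE scalerDl scalerA.
pose fL : {linear V -> 'M[R]_m.+1} :=
  HB.pack f (GRing.isLinear.Build R V 'M[R]_m.+1 _ f f_lin).
suff ff v : fL v * fL v = (Phi v)%:A.
  move=> /(clifford_ideal_sub ff) /eqP.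
  by rewrite rmorph1 oner_eq0.
have e1 : fL v * fL v = \sum_i \sum_j (v i 0 * v j 0) *: (E i *m E j).
  rewrite /= /f mulr_suml; apply: eq_bigr => i _.
  rewrite mulr_sumr; apply: eq_bigr => j _.
  by rewrite -scalerAl -scalerAr scalerA.
have e2 : fL v * fL v = \sum_i \sum_j (v i 0 * v j 0) *: (E j *m E i).
  rewrite e1 exchange_big /=; apply: eq_bigr => i _; apply: eq_bigr => j _.
  by rewrite mulrC.
apply: (@scalerI _ _ (2%:R : R)); first by rewrite pnatr_eq0.
rewrite scaler_nat mulr2n {1}e1 e2 -big_split /= PhiE scaler_suml scaler_sumr.
apply: eq_bigr => i _; rewrite -big_split /= (bigD1 i) //= big1 => [|j ji].
  rewrite -scalerDr HE // eqxx mulr1n addr0 scale_scalar_mx -scalemx1 scalerA.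
  by rewrite mulrnAr -expr2 [_ * signature i]mulrC mulr_natl.
rewrite -scalerDr HE // (_ : (_ == _) = false) ?mulr0n ?raddf0 ?scaler0 //.
by apply: contraNF ji => /eqP/val_inj ->.
Qed.

Fact clifford_1_neq0 : clifford_pi 1 != 0.
Proof.
apply/eqP; rewrite -(raddf0 clifford_pi) => /clifford_piP.
by rewrite subr0; apply: clifford_ideal_proper.
Qed.

HB.instance Definition _ := GRing.Zmodule_isNzRing.Build clifford
  clifford_mulA clifford_mul1 clifford_mulr1 clifford_mulDl clifford_mulDr
  clifford_1_neq0.

Fact clifford_pi_monoid : monoid_morphism clifford_pi.
Proof. by split=> // x y; rewrite -[RHS]/(clifford_mul _ _) clifford_mulE. Qed.
HB.instance Definition _ :=
  GRing.isMonoidMorphism.Build T clifford clifford_pi clifford_pi_monoid.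

Fact clifford_scaleA a b x :
  clifford_scale a (clifford_scale b x) = clifford_scale (a * b) x.
Proof.
by elim/clifford_pi_surj: x => x; rewrite !clifford_scaleE scalerA.
Qed.

Fact clifford_scale1 : left_id 1 clifford_scale.
Proof. by elim/clifford_pi_surj => x; rewrite clifford_scaleE scale1r. Qed.

Fact clifford_scaleDr : right_distributive clifford_scale +%R.
Proof.
move=> a; elim/clifford_pi_surj => x; elim/clifford_pi_surj => y.
by rewrite -raddfD !clifford_scaleE -raddfD /= scalerDr.
Qed.

Fact clifford_scaleDl x : {morph clifford_scale^~ x : a b / a + b}.
Proof.
move=> a b; elim/clifford_pi_surj: x => x.
by rewrite !clifford_scaleE -raddfD /= scalerDl.
Qed.

HB.instance Definition _ := GRing.Zmodule_isLmodule.Build R clifford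
  clifford_scaleA clifford_scale1 clifford_scaleDr clifford_scaleDl.

Fact clifford_pi_scalable : scalable clifford_pi.
Proof.
by move=> a x; rewrite -[RHS]/(clifford_scale _ _) clifford_scaleE.
Qed.
HB.instance Definition _ :=
  GRing.isScalable.Build R T clifford _ clifford_pi clifford_pi_scalable.

Fact clifford_scaleAl (a : R) (x y : clifford) : a *: (x * y) = a *: x * y.
Proof.
elim/clifford_pi_surj: x => x; elim/clifford_pi_surj: y => y.
by rewrite -rmorphM -!linearZ -rmorphM /= scalerAl.
Qed.
HB.instance Definition _ :=
  GRing.Lmodule_isLalgebra.Build R clifford clifford_scaleAl.

Fact clifford_scaleAr (a : R) (x y : clifford) : a *: (x * y) = x * (a *: y).
Proof.
elim/clifford_pi_surj: x => x; elim/clifford_pi_surj: y => y.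
by rewrite -rmorphM -!linearZ -rmorphM /= scalerAr.
Qed.
HB.instance Definition _ :=
  GRing.Lalgebra_isAlgebra.Build R clifford clifford_scaleAr.

Definition clifford_unit : pred clifford :=
  fun x => `[< exists y, y * x = 1 /\ x * y = 1 >].
Definition clifford_inv (x : clifford) : clifford :=
  xget x [set y | y * x = 1 /\ x * y = 1].

Fact clifford_mulVx : {in clifford_unit, left_inverse 1 clifford_inv *%R}.
Proof. by move=> x /asboolP/(xgetPex x)[]. Qed.

Fact clifford_mulxV : {in clifford_unit, right_inverse 1 clifford_inv *%R}.
Proof. by move=> x /asboolP/(xgetPex x)[]. Qed.

Fact clifford_unitP x y : y * x = 1 /\ x * y = 1 -> clifford_unit x.
Proof. by move=> yx; apply/asboolP; exists y. Qed.

Fact clifford_inv_out : {in [predC clifford_unit], clifford_inv =1 id}.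
Proof. by move=> x /asboolPn xU; apply: xgetPN => y yx; apply: xU; exists y. Qed.

HB.instance Definition _ := GRing.NzRing_hasMulInverse.Build clifford
  clifford_mulVx clifford_mulxV clifford_unitP clifford_inv_out.

Definition clifford_vec (v : V) : clifford := clifford_pi (tensor_vec v).

Fact clifford_vec_linear : linear clifford_vec.
Proof. by move=> a u v; rewrite /clifford_vec !linearP. Qed.
HB.instance Definition _ :=
  GRing.isLinear.Build R V clifford _ clifford_vec clifford_vec_linear.

Lemma clifford_vec_sqr (v : V) : clifford_vec v * clifford_vec v = (Phi v)%:A.
Proof.
rewrite /clifford_vec -rmorphM /= -(rmorph1 clifford_pi) -linearZ /=.
by apply/clifford_piP => I [_ HI]; apply: HI; exists v.
Qed.

Lemma clifford_vec_inj : injective clifford_vec.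
Proof.
suff ker v : clifford_vec v = 0 -> v = 0.
  by move=> u v uv; apply/subr0_eq/ker; rewrite raddfB /= uv subrr.
move=> v0; have PhiD w : Phi (v + w) = Phi w.
  have := clifford_vec_sqr (v + w); rewrite raddfD /= v0 add0r clifford_vec_sqr.
  by move/(fmorph_inj (in_alg clifford)) ->.
have Phi0 : Phi v = 0.
  by rewrite -[v]addr0 PhiD PhiE big1 // => i _; rewrite mxE expr0n mulr0.
apply/matrixP => i j; rewrite ord1 mxE {j}.
have := PhiD (delta_mx i 0); rewrite !PhiE.
have -> : \sum_(j < p + q) signature j * (v + delta_mx i 0) j 0 ^+ 2 =
   Phi v + 2 * signature i * v i 0 +
     \sum_(j < p + q) signature j * (delta_mx i 0 : V) j 0 ^+ 2.
  have -> : 2 * signature i * v i 0 =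
      \sum_(j < p + q) 2 * signature j * v j 0 * (delta_mx i 0 : V) j 0.
    rewrite (bigD1 i) //= big1 => [|j ji]; rewrite !mxE ?eqxx.
      by rewrite addr0 mulr1.
    by rewrite (negbTE ji) mulr0.
  rewrite PhiE -!big_split /=; apply: eq_bigr => j _; rewrite !mxE.
  by ring.
rewrite Phi0 add0r => /(canRL (addrK _)); rewrite subrr => /eqP.
rewrite !mulf_eq0 pnatr_eq0 /= /signature.
by case: ifP => _; rewrite ?oppr_eq0 oner_eq0 /= => /eqP.
Qed.

Section Lift.
Context (A : algType R) (f : {linear V -> A}).

Local Notation clifford_lift := (clifford_lift f).
Hypothesis f_sqr : forall v, f v * f v = (Phi v)%:A.

Fact clifford_lift_pi x : clifford_lift (clifford_pi x) = tensor_lift f x.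
Proof.
rewrite clifford_lift.unlock.
apply/eqP; rewrite -subr_eq0 -raddfB; apply/eqP/clifford_ideal_sub => //.
by apply/clifford_piP; rewrite clifford_pi_repr.
Qed.

Fact clifford_lift_zmod : zmod_morphism clifford_lift.
Proof.
elim/clifford_pi_surj => x; elim/clifford_pi_surj => y.
by rewrite -raddfB !clifford_lift_pi raddfB.
Qed.

Fact clifford_lift_monoid : monoid_morphism clifford_lift.
Proof.
split; first by rewrite -(rmorph1 clifford_pi) clifford_lift_pi rmorph1.
elim/clifford_pi_surj => x; elim/clifford_pi_surj => y.
by rewrite -rmorphM !clifford_lift_pi rmorphM.
Qed.

Fact clifford_lift_scalable : scalable clifford_lift.
Proof.
move=> a; elim/clifford_pi_surj => x.
by rewrite -linearZ !clifford_lift_pi linearZ.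
Qed.

Lemma clifford_lift_vec v : clifford_lift (clifford_vec v) = f v.
Proof. by rewrite clifford_lift_pi tensor_lift_vec. Qed.

End Lift.

Lemma clifford_ext (A : algType R) (f g : {lrmorphism clifford -> A}) :
  (forall v, f (clifford_vec v) = g (clifford_vec v)) -> f =1 g.
Proof.
move=> fg; elim/clifford_pi_surj => x.
exact: (tensor_ext (f := f \o clifford_pi) (g := g \o clifford_pi)).
Qed.

End CliffordRing.

(* A with the reversed product, so that an algebra morphism into converse_alg A  *)
(* is an anti-morphism into A; the library's A^c is not equipped with a scaling. *)
Definition converse_alg (R : realType) (A : algType R) : Type := A.

Section ConverseAlgebra.
Context (R : realType) (A : algType R).
Local Notation Ac := (converse_alg A).

HB.instance Definition _ := GRing.Lmodule.copy Ac A.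

Fact converse_mulDl : left_distributive (fun x y : A => y * x) +%R.
Proof. by move=> x y z; rewrite mulrDr. Qed.
Fact converse_mulDr : right_distributive (fun x y : A => y * x) +%R.
Proof. by move=> x y z; rewrite mulrDl. Qed.
Fact converse_mulA : associative (fun x y : A => y * x).
Proof. by move=> x y z; rewrite mulrA. Qed.
HB.instance Definition _ := GRing.Zmodule_isNzRing.Build Ac converse_mulA
  (@mulr1 A) (@mul1r A) converse_mulDl converse_mulDr (oner_neq0 A).

Fact converse_scaleAl (a : R) (x y : Ac) :
  a *: (x * y) = (a *: x : Ac) * y.
Proof. exact: (@scalerAr R A a y x). Qed.
HB.instance Definition _ := GRing.Lmodule_isLalgebra.Build R Ac converse_scaleAl.

Fact converse_scaleAr (a : R) (x y : Ac) :
  a *: (x * y) = x * (a *: y : Ac).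
Proof. exact: (@scalerAl R A a y x). Qed.
HB.instance Definition _ := GRing.Lalgebra_isAlgebra.Build R Ac converse_scaleAr.

Lemma converse_mulE (x y : A) : (x : Ac) * (y : Ac) = y * x :> A.
Proof. by []. Qed.

End ConverseAlgebra.

Section Involutions.
Context (R : realType) (p q : nat).
Local Notation V := 'cV[R]_(p + q).
Local Notation Cl := (clifford R p q).

(* The automorphism alpha and the anti-automorphism reversal (t) are induced by  *)
(* v |-> - v and v |-> v through the universal property of the Clifford algebra; *)
(* clifford_ext shows that they are the only morphisms extending these maps.     *)
Definition clifford_vec_neg (v : V) : Cl := - clifford_vec v.
Fact clifford_vec_neg_linear : linear clifford_vec_neg.
Proof. by move=> a u v; rewrite /clifford_vec_neg linearP opprD scalerN. Qed.
HB.instance Definition _ :=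
  GRing.isLinear.Build R V Cl _ clifford_vec_neg clifford_vec_neg_linear.

Definition alpha : Cl -> Cl := clifford_lift clifford_vec_neg.

Fact clifford_vec_neg_sqr v : clifford_vec_neg v * clifford_vec_neg v = (Phi v)%:A.
Proof. by rewrite mulrNN clifford_vec_sqr. Qed.

HB.instance Definition _ := GRing.isZmodMorphism.Build Cl Cl alpha
  (clifford_lift_zmod clifford_vec_neg_sqr).
HB.instance Definition _ := GRing.isMonoidMorphism.Build Cl Cl alpha
  (clifford_lift_monoid clifford_vec_neg_sqr).
HB.instance Definition _ := GRing.isScalable.Build R Cl Cl _ alpha
  (clifford_lift_scalable clifford_vec_neg_sqr).

Lemma alpha_vec v : alpha (clifford_vec v) = - clifford_vec v.
Proof. exact: (clifford_lift_vec clifford_vec_neg_sqr). Qed.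

Lemma alphaK : involutive alpha.
Proof.
apply: (clifford_ext (f := alpha \o alpha) (g := idfun)) => v /=.
by rewrite alpha_vec raddfN /= alpha_vec opprK.
Qed.

Definition clifford_vec_converse : V -> converse_alg Cl := @clifford_vec R p q.
Fact clifford_vec_converse_linear : linear clifford_vec_converse.
Proof. exact: clifford_vec_linear. Qed.
HB.instance Definition _ :=
  GRing.isLinear.Build R V (converse_alg Cl) _ clifford_vec_converse
    clifford_vec_converse_linear.

Definition reversal : Cl -> Cl := clifford_lift clifford_vec_converse.

Fact clifford_vec_converse_sqr v :
  clifford_vec_converse v * clifford_vec_converse v = (Phi v)%:A.
Proof. exact: clifford_vec_sqr. Qed.

Fact reversal_zmod : zmod_morphism reversal.
Proof. exact: (clifford_lift_zmod clifford_vec_converse_sqr). Qed.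
HB.instance Definition _ := GRing.isZmodMorphism.Build Cl Cl reversal
  reversal_zmod.

Fact reversal_scalable : scalable reversal.
Proof. exact: (clifford_lift_scalable clifford_vec_converse_sqr). Qed.
HB.instance Definition _ := GRing.isScalable.Build R Cl Cl _ reversal
  reversal_scalable.

Lemma reversal1 : reversal 1 = 1.
Proof. by have [] := clifford_lift_monoid clifford_vec_converse_sqr. Qed.

Lemma reversalM x y : reversal (x * y) = reversal y * reversal x.
Proof.
rewrite -[RHS](@converse_mulE R Cl).
exact: ((clifford_lift_monoid clifford_vec_converse_sqr).2 x y).
Qed.

Lemma reversal_vec v : reversal (clifford_vec v) = clifford_vec v.
Proof. exact: (clifford_lift_vec clifford_vec_converse_sqr). Qed.

Fact reversal2_monoid : monoid_morphism (reversal \o reversal).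
Proof. by split=> [|x y] /=; rewrite ?reversal1 ?reversalM. Qed.

Lemma reversalK : involutive reversal.
Proof.
pose rr : {lrmorphism Cl -> Cl} := HB.pack (reversal \o reversal)
  (GRing.isMonoidMorphism.Build Cl Cl (reversal \o reversal) reversal2_monoid).
by apply: (clifford_ext (f := rr) (g := idfun)) => v /=; rewrite !reversal_vec.
Qed.

Definition bar (x : Cl) : Cl := reversal (alpha x).

Definition spinor_norm (x : Cl) : Cl := x * bar x.

Definition Cl0 : set Cl := [set x | alpha x = x].

Definition Gamma : set Cl :=
  [set x | x \is a GRing.unit /\
    forall v : V, exists w : V, alpha x * clifford_vec v * x^-1 = clifford_vec w].

Definition Gamma_plus : set Cl := Gamma `&` Cl0.

(* The matrix of v |-> alpha x * v * x^-1 in the standard basis; junk (0) for x  *)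
(* outside Gamma.                                                                *)
Definition rho (x : Cl) : 'M[R]_(p + q) :=
  xget 0 [set A | forall v : V, clifford_vec (A *m v) = alpha x * clifford_vec v * x^-1].

Lemma rhoP x v : Gamma x -> clifford_vec (rho x *m v) = alpha x * clifford_vec v * x^-1.
Proof.
move=> [xU xG]; pose e i : V := delta_mx i 0.
have /choice[w wP] i : exists w, alpha x * clifford_vec (e i) * x^-1 = clifford_vec w by [].
suff: [set A | forall v : V, clifford_vec (A *m v) = alpha x * clifford_vec v * x^-1]
        (\matrix_(i, j) w j i 0) by move=> /(xgetI 0).
move=> /= {}v; have -> : (\matrix_(i, j) w j i 0) *m v = \sum_j v j 0 *: w j.
  apply/matrixP => i k; rewrite ord1 mxE summxE.
  by apply: eq_bigr => j _; rewrite !mxE mulrC.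
rewrite [in RHS](col_sum_delta v) !linear_sum mulr_sumr mulr_suml /=.
by apply: eq_bigr => j _; rewrite !linearZ /= -scalerAr -scalerAl wP.
Qed.

Definition Pin : set Cl :=
  [set x | Gamma x /\ (spinor_norm x = 1 \/ spinor_norm x = -1)].

Definition Spin : set Cl := Pin `&` Gamma_plus.

(* Linear maps of R^n are matrices acting on column vectors. *)
Definition O_indef : set 'M[R]_(p + q) :=
  [set A | forall v : V, Phi (A *m v) = Phi v].

Definition SO_indef : set 'M[R]_(p + q) := [set A | O_indef A /\ \det A = 1].

End Involutions.

Arguments Gamma : clear implicits.
Arguments Pin : clear implicits.
Arguments Spin : clear implicits.
Arguments O_indef : clear implicits.
Arguments SO_indef : clear implicits.

Definition unit_subgroup (A : pzRingType) (G : set A) : Prop :=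
  [/\ G 1, forall x y, G x -> G y -> G (x * y)
         & forall x, G x -> exists2 y, G y & y * x = 1 /\ x * y = 1].

Definition group_hom (A B : pzRingType) (G : set A) (H : set B) (f : A -> B) :
    Prop :=
  [/\ unit_subgroup G, unit_subgroup H, set_fun G H f
    & forall x y, G x -> G y -> f (x * y) = f x * f y].

Definition group_ker (A B : pzRingType) (G : set A) (f : A -> B) : set A :=
  [set x | G x /\ f x = 1].

(* Main.v *)
(* A unit vector v lies in Pin, and rho v is the reflection in the hyperplane    *)
(* orthogonal to v; hence surjectivity is the fact that reflections in           *)
(* nonisotropic vectors generate O(p, q).  An x in the kernel satisfies          *)
(* alpha(x) v = v x for all v, which forces it to be a scalar c, and             *)
(* N(x) = c^2 = +-1 leaves c = +-1.  Consequently every element of Pin is, up to *)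
(* sign, a product of k unit vectors, and the parity of k determines both the    *)
(* parity of x in the Clifford algebra and the determinant (-1)^k of rho x.      *)

Require Import Defs.
From mathcomp Require Import all_boot all_order all_algebra.
From mathcomp Require Import boolp classical_sets functions reals.
From mathcomp.multinomials Require Import monalg.
From mathcomp Require Import ring.

Import GRing.Theory Num.Theory.
Local Open Scope classical_set_scope.
Local Open Scope ring_scope.
Set Implicit Arguments.
Unset Strict Implicit.
Unset Printing Implicit Defensive.

(** Twisted conjugation preserves the squares of vectors, so [rho] takes values in the isometries
    ([rho_O]), and the Clifford relation makes a nonisotropic vector act as a reflection
    ([Gamma_vec]). Over the reals such a vector can be rescaled into Pin without changing its
    action, and these reflections generate O(p,q) ([cartan_dieudonne]), whence surjectivity. The
    kernel is found by showing that the twisted centre consists of scalars ([twisted_center]),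
    stripping one generator at a time. For Spin, [versorP] attaches the same sign to the parity and
    to the determinant of a product of vectors, and [Pin_versor] carries this over to all of Pin. *)

Lemma det_1_sub_rank1 (K : comNzRingType) (n : nat) (u : 'cV[K]_n)
    (v : 'rV[K]_n) :
  \det (1%:M - u *m v) = 1 - (v *m u) 0 0.
Proof.
(* One block matrix is factored into block triangular ones in two ways, eliminating one corner or
   the other; the two determinants are compared. *)
have e1 : block_mx 1%:M u v 1%:M = 
  block_mx 1%:M 0 v 1%:M *m block_mx 1%:M u 0 (1%:M - v *m u).
  rewrite mulmx_block !(mul1mx, mul0mx, mulmx0, mulmx1, addr0, add0r).
  by rewrite addrC subrK.
have e2 : block_mx 1%:M u v 1%:M = 
  block_mx (1%:M - u *m v) u 0 1%:M *m block_mx 1%:M 0 v 1%:M.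
  rewrite mulmx_block !(mul1mx, mul0mx, mulmx0, mulmx1, addr0, add0r).
  by rewrite subrK.
have := e2; rewrite e1 => /(congr1 determinant).
rewrite !det_mulmx det_lblock !det_ublock !det1 !mul1r !mulr1 => <-.
by rewrite det_mx11 !mxE.
Qed.

(** Polarization of the squaring map; for vectors it becomes the Clifford relation [vec_mulC]. *)
Lemma mul_anticomm_polarization (K : pzRingType) (A : lalgType K)
    (x y : A) (a b c : K) :
  x * x = a%:A -> y * y = b%:A -> (x + y) * (x + y) = (a + b + c)%:A ->
  x * y = c%:A - y * x.
Proof.
move=> xx yy; rewrite mulrDl !mulrDr [y * x + _]addrC addrACA xx yy !scalerDl.
by move/addrI <-; rewrite addrK.
Qed.

Lemma mulrD_anticomm (A : pzRingType) (x y a b : A) : x * y = - (y * x) ->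
  y * (a + x * b) = y * a + x * - (y * b).
Proof. by move=> xy; rewrite mulrDr mulrN !mulrA xy mulNr opprK. Qed.

Section Pinor.
Context (R : realType) (p q : nat).
Local Notation V := 'cV[R]_(p + q).
Local Notation Cl := (clifford R p q).
Local Notation vec := (@clifford_vec R p q).
Local Notation e i := (delta_mx i 0 : V).
Local Notation Phi := (@Phi R p q).

(** * The polar form of [Phi] and the group of isometries *)

Definition sig_mx : 'M[R]_(p + q) :=
  diag_mx (\row_i signature R p i).

Definition bil (u v : V) : R := (u^T *m sig_mx *m v) 0 0.

Lemma bilE u v : bil u v = \sum_(i < p + q) signature R p i * u i 0 * v i 0.
Proof.
rewrite /bil mxE; apply: eq_bigr => i _.
by rewrite /sig_mx mul_mx_diag !mxE [u i 0 * _]mulrC.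
Qed.

Lemma bil_diag v : bil v v = Phi v.
Proof. by rewrite bilE PhiE; apply: eq_bigr => i _; rewrite expr2 mulrA. Qed.

Lemma bilC u v : bil u v = bil v u.
Proof. by rewrite !bilE; apply: eq_bigr => i _; rewrite mulrAC. Qed.

Lemma bilDr u v w : bil u (v + w) = bil u v + bil u w.
Proof. by rewrite /bil mulmxDr mxE. Qed.

Lemma bilNr u v : bil u (- v) = - bil u v.
Proof. by rewrite /bil mulmxN mxE. Qed.

Lemma bilDl u v w : bil (u + v) w = bil u w + bil v w.
Proof. by rewrite bilC bilDr !(bilC _ w). Qed.

Lemma bilNl u v : bil (- u) v = - bil u v.
Proof. by rewrite bilC bilNr bilC. Qed.

Lemma PhiD u v : Phi (u + v) = Phi u + Phi v + 2 * bil u v.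
Proof. rewrite -!bil_diag bilDl !bilDr (bilC v u); ring. Qed.

Lemma PhiZ (c : R) v : Phi (c *: v) = c ^+ 2 * Phi v.
Proof.
rewrite !PhiE mulr_sumr; apply: eq_bigr => i _.
by rewrite mxE exprMn mulrCA.
Qed.

Lemma signature_sqr i : signature R p i * signature R p i = 1.
Proof. by rewrite /signature; case: ifP; rewrite ?mulrNN mulr1. Qed.

Lemma signature_neq0 i : signature R p i != 0.
Proof. by rewrite /signature; case: ifP; rewrite ?oppr_eq0 oner_eq0. Qed.

Lemma bil_deltal i v : bil (e i) v = signature R p i * v i 0.
Proof.
rewrite bilE (bigD1 i) //= big1 => [|j ji]; rewrite !mxE ?eqxx ?mulr1 ?addr0 //.
by rewrite (negbTE ji) mulr0 mul0r.
Qed.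

Lemma bil_delta i j : bil (e i) (e j) = sig_mx i j.
Proof.
rewrite bil_deltal !mxE eqxx andbT.
by case: eqVneq => [->|_]; rewrite ?mulr1 ?mulr0 ?mulr1n ?mulr0n.
Qed.

Lemma sig_mx_sqr : sig_mx *m sig_mx = 1%:M.
Proof.
apply/matrixP => i j; rewrite mul_diag_mx !mxE.
by case: eqVneq => [->|_]; rewrite ?mulr1n ?signature_sqr // mulr0n mulr0.
Qed.

Lemma O_bil A u v : O_indef R p q A -> bil (A *m u) (A *m v) = bil u v.
Proof.
move=> OA; have := PhiD (A *m u) (A *m v); have := PhiD u v.
rewrite -mulmxDr !OA => -> /addrI /mulfI -> //.
by rewrite pnatr_eq0.
Qed.

(** With J = [sig_mx], an isometry satisfies A^T J A = J; as J^2 = 1, J A^T J is a left inverse of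
    A. *)
Lemma O_unitmx A : O_indef R p q A -> A \in unitmx.
Proof.
move=> OA; suff: A^T *m sig_mx *m A = sig_mx.
  move=> AJ; have : (sig_mx *m A^T *m sig_mx) *m A = 1%:M.
    by rewrite -!mulmxA [A^T *m _]mulmxA AJ sig_mx_sqr.
  by case/mulmx1_unit.
apply/matrixP => i j; rewrite -bil_delta -(O_bil _ _ OA) /bil.
rewrite trmx_mul trmx_delta.
have <- : ((delta_mx 0 i : 'rV[R]_(p + q)) *m (A^T *m sig_mx *m A) *m e j) 0 0 =
    (A^T *m sig_mx *m A) i j by rewrite -rowE -colE !mxE.
by rewrite !mulmxA.
Qed.

Lemma O_group : unit_subgroup (O_indef R p q).
Proof.
split=> [v|A B OA OB v|A OA]; first by rewrite mul1mx.
  by rewrite -mulmxA OA OB.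
exists (invmx A).
  by move=> v; rewrite -[in RHS](mulKVmx (O_unitmx OA) v) OA.
by split; [apply: mulVmx|apply: mulmxV]; apply: O_unitmx.
Qed.

(** * Generators, the Clifford relation and reflections *)

(** Words in the basis vectors span the tensor algebra, hence its quotient; the proof is by
    induction on words. *)
Lemma clifford_ind (P : Cl -> Prop) :
  P 1 -> (forall a x y, P x -> P y -> P (a *: x + y)) ->
  (forall i x, P x -> P (vec (e i) * x)) -> forall x, P x.
Proof.
move=> P1 PD PM; have P0 : P 0 by rewrite -[0](addNr 1) -scaleN1r; apply: PD.
elim/clifford_pi_surj => x; rewrite [x : {malg R[_]}]monalgE raddf_sum /=.
elim/big_ind: _ => // [y z Py Pz|w _]; first by rewrite -[y]scale1r; apply: PD.
move: (x@_w) => c.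
have vecE i : tensor_vec (e i) = << fmu i >>.
  rewrite /tensor_vec (bigD1 i) //= big1 => [|j ji]; rewrite !mxE eqxx.
    by rewrite eqxx addr0.
  by rewrite (negbTE ji) monalgU0.
have -> : << c *g w >> = c *: << w >> :> {malg R[{fmonom 'I_(p + q)}]}.
  by rewrite -mul_malgC malgM_def fgmulUU mulr1 mul1m.
rewrite linearZ /= -[_ *: _]addr0; apply: PD => //.
case: w => w; elim: w => [|i w IHw].
  have -> : << FMonom [::] >> = 1 :> tensor_algebra R (p + q).
    by rewrite -fmoneE.
  by rewrite rmorph1.
have -> : << FMonom (i :: w) >> =
    tensor_vec (e i) * << FMonom w >> :> tensor_algebra R (p + q).
  rewrite vecE malgM_def fgmulUU mulr1; congr << _ *g _ >>.
  by apply/esym/eqP; rewrite fmP fmM fmU.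
by rewrite rmorphM /=; apply: PM.
Qed.

Lemma vec_mulC u v : vec u * vec v = (2 * bil u v)%:A - vec v * vec u.
Proof.
apply: mul_anticomm_polarization (clifford_vec_sqr u) (clifford_vec_sqr v) _.
by rewrite -PhiD -clifford_vec_sqr -raddfD.
Qed.

Lemma vec_unit v : Phi v != 0 ->
  vec v \is a GRing.unit /\ (vec v)^-1 = (Phi v)^-1 *: vec v.
Proof.
move=> v0.
have vV : (Phi v)^-1 *: vec v * vec v = 1.
  by rewrite -scalerAl clifford_vec_sqr scalerA mulVf ?scale1r.
have Vv : vec v * ((Phi v)^-1 *: vec v) = 1 by rewrite -scalerAr scalerAl.
have vU : vec v \is a GRing.unit by apply/unitrP; exists ((Phi v)^-1 *: vec v).
by split=> //; rewrite -[LHS]mul1r -vV mulrK.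
Qed.

(** Written as the identity minus a column times a row, so that [det_1_sub_rank1] applies. *)
Definition reflection_mx v : 'M[R]_(p + q) :=
  1%:M - v *m ((2 / Phi v) *: (v^T *m sig_mx)).

Lemma reflection_mxE v w :
  reflection_mx v *m w = w - (2 * bil v w / Phi v) *: v.
Proof.
rewrite mulmxBl mul1mx -mulmxA -scalemxAl [_ *m w]mx11_scalar -/(bil v w).
by rewrite -scalemxAr mul_mx_scalar scalerA mulrAC.
Qed.

Lemma det_reflection_mx v : Phi v != 0 -> \det (reflection_mx v) = -1.
Proof.
move=> v0; rewrite det_1_sub_rank1 -scalemxAl mxE -/(bil v v) bil_diag divfK //.
by ring.
Qed.

(** * The Clifford group and its twisted action *)

(** Since [rho] is defined by choice, its value is identified through the injectivity of the
    embedding of vectors. *)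
Lemma Gamma_intro x (A : 'M[R]_(p + q)) : x \is a GRing.unit ->
  (forall v, vec (A *m v) = alpha x * vec v * x^-1) ->
  Gamma R p q x /\ rho x = A.
Proof.
move=> xU xA; have xG : Gamma R p q x.
  by split=> // v; exists (A *m v); rewrite xA.
split=> //; apply/matrixP => i j.
suff: rho x *m e j = A *m e j.
  by rewrite -!colE => /colP/(_ i); rewrite !mxE.
by apply: (@clifford_vec_inj R p q); rewrite rhoP // xA.
Qed.

Lemma GammaM x y : Gamma R p q x -> Gamma R p q y ->
  Gamma R p q (x * y) /\ rho (x * y) = rho x *m rho y.
Proof.
move=> xG yG; apply: Gamma_intro => [|v].
  by case: xG yG => [xU _] [yU _]; rewrite unitrMl.
by rewrite -mulmxA !rhoP // rmorphM /= invrM ?mulrA //; [case: xG|case: yG].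
Qed.

Lemma GammaZ (c : R) x : c != 0 -> Gamma R p q x ->
  Gamma R p q (c *: x) /\ rho (c *: x) = rho x.
Proof.
move=> c0 xG; have [xU _] := xG; apply: Gamma_intro => [|v].
  by rewrite scaler_unit ?unitfE.
rewrite rhoP // linearZ /= invrZ ?unitfE // -!scalerAl -scalerAr scalerA.
by rewrite divff ?scale1r.
Qed.

Lemma Gamma1 : Gamma R p q 1 /\ rho (1 : Cl) = 1%:M.
Proof.
apply: Gamma_intro => [|v]; first exact: unitr1.
by rewrite (rmorph1 (@alpha R p q)) mul1mx invr1 mul1r mulr1.
Qed.

(* A vector is fixed by - alpha, so w := rho x v is both alpha(x) v x^-1 and      *)
(* x v alpha(x)^-1; the product of the two expressions is Phi v.                 *)
Lemma rho_O x : Gamma R p q x -> O_indef R p q (rho x).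
Proof.
move=> xG v; have [xU _] := xG; apply: (fmorph_inj (in_alg Cl)) => /=.
have axU : alpha x \is a GRing.unit by apply: rmorph_unit.
rewrite -!clifford_vec_sqr -{2}[vec (_ *m _)]opprK -alpha_vec rhoP //.
rewrite !rmorphM /= alphaK alpha_vec rmorphV //= !(mulrN, mulNr) opprK.
rewrite -!mulrA mulKr // [vec v * (vec v * _)]mulrA clifford_vec_sqr.
by rewrite mulr_algl -scalerAr mulrV.
Qed.

(** As an isometry, [rho x] is invertible, so every vector has the form alpha(x) w x^-1 with w a
    vector, and the twisted action of x^-1 sends it back to w. *)
Lemma GammaV x : Gamma R p q x -> Gamma R p q x^-1.
Proof.
move=> xG; have [xU _] := xG; have OU := O_unitmx (rho_O xG).
have axU : alpha x \is a GRing.unit by apply: rmorph_unit.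
case: (@Gamma_intro x^-1 (invmx (rho x))) => // [|v]; first by rewrite unitrV.
have := rhoP (invmx (rho x) *m v) xG; rewrite mulKVmx // => ->.
by rewrite invrK rmorphV //= -!mulrA mulVr // mulr1 mulKr.
Qed.

(** By the Clifford relation, - v w v^-1 = w - 2 B(v,w) v^-1, with v^-1 = v / Phi(v); the minus sign
    comes from [alpha]. *)
Lemma Gamma_vec v : Phi v != 0 ->
  Gamma R p q (vec v) /\ rho (vec v) = reflection_mx v.
Proof.
move=> v0; have [vU vV] := vec_unit v0; apply: Gamma_intro => // w.
rewrite reflection_mxE alpha_vec mulNr vec_mulC opprB mulrBl mulrK //.
by rewrite vV mulr_algl scalerA linearB linearZ.
Qed.

(** * Pin, Spin and SO as groups *)

Lemma bar1 : bar (1 : Cl) = 1.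
Proof. by rewrite /bar rmorph1 reversal1. Qed.

Lemma barM (x y : Cl) : bar (x * y) = bar y * bar x.
Proof. by rewrite /bar rmorphM reversalM. Qed.

Lemma barN (x : Cl) : bar (- x) = - bar x.
Proof. by rewrite /bar !raddfN. Qed.

Lemma Pin1 : Pin R p q 1.
Proof. by split; [case: Gamma1|left; rewrite /spinor_norm bar1 mulr1]. Qed.

Lemma PinM x y : Pin R p q x -> Pin R p q y -> Pin R p q (x * y).
Proof.
move=> [xG xN] [yG yN]; split; first by case: (GammaM xG yG).
(* The inner factor N(y) is 1 or -1, hence central, and can be pulled out. *)
have -> : spinor_norm (x * y) = x * spinor_norm y * bar x.
  by rewrite /spinor_norm barM !mulrA.
case: yN => ->; first by rewrite mulr1.
by rewrite mulrN1 mulNr; case: xN; rewrite /spinor_norm => ->; rewrite ?opprK; auto.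
Qed.

Lemma PinN x : Pin R p q x -> Pin R p q (- x).
Proof.
move=> [xG xN]; split; last by rewrite /spinor_norm barN mulrNN.
by rewrite -scaleN1r; case: (GammaZ (c := -1) _ xG); rewrite ?oppr_eq0 ?oner_eq0.
Qed.

(** N(x) = 1 or -1 means that [bar x] is x^-1 up to sign, and [bar] of x^-1 is the inverse of
    [bar x]. *)
Lemma PinV x : Pin R p q x -> Pin R p q x^-1.
Proof.
move=> [xG xN]; split; first exact: GammaV.
have [xU _] := xG.
have bx : bar x^-1 * bar x = 1 by rewrite -barM mulrV ?bar1.
case: xN; rewrite /spinor_norm => xN; [left|right].
  have xV : bar x = x^-1 by rewrite -[bar x](mulKr xU) xN mulr1.
  have -> : bar x^-1 = x by rewrite -[RHS]mul1r -bx xV mulrVK.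
  by rewrite mulVr.
have xV : bar x = - x^-1 by rewrite -[bar x](mulKr xU) xN mulrN1.
have -> : bar x^-1 = - x by rewrite -[RHS]mul1r -bx xV !mulrN mulNr opprK mulrVK.
by rewrite mulrN mulVr.
Qed.

Lemma Pin_group : unit_subgroup (Pin R p q).
Proof.
split; [exact: Pin1|exact: PinM|move=> x xP].
have [[xU _] _] := xP.
by exists x^-1; [exact: PinV|rewrite mulVr ?mulrV].
Qed.

Lemma Spin_group : unit_subgroup (Spin R p q).
Proof.
split=> [|x y [xP [xG xe]] [yP [yG ye]]|x [xP [xG xe]]].
- split; first exact: Pin1.
  by split; [case: Gamma1|rewrite /Cl0 /= rmorph1].
- split; first exact: PinM.
  by split; [case: (GammaM xG yG)|rewrite /Cl0 /= rmorphM /= xe ye].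
- have [xU _] := xG.
  exists x^-1; last by rewrite mulVr ?mulrV.
  split; first exact: PinV.
  by split; [exact: GammaV|rewrite /Cl0 /= rmorphV //= xe].
Qed.

Lemma SO_group : unit_subgroup (SO_indef R p q).
Proof.
have [O1 OM OV] := O_group; split=> [|A B [OA dA] [OB dB]|A [OA dA]].
- by split; rewrite ?det1.
- by split; [exact: OM|rewrite det_mulmx dA dB mulr1].
- have [B OB [BA AB]] := OV _ OA; exists B => //; split=> //.
  by have := congr1 determinant BA; rewrite det_mulmx dA mulr1 det1.
Qed.

(** * The twisted centre and the kernel *)

Lemma vec_anticomm (i j : 'I_(p + q)) : i != j ->
  vec (e i) * vec (e j) = - (vec (e j) * vec (e i)).
Proof.
move=> ij; have b0 : 2 * bil (e i) (e j) = 0.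
  by rewrite bil_delta mxE (negbTE ij) mulr0n mulr0.
have h := vec_mulC (e i) (e j); rewrite b0 scale0r add0r in h.
exact: h.
Qed.

(* The subalgebra generated by the basis vectors e_i with k <= i; only the fact  *)
(* that its elements are reached by these rules matters, never a basis of it.    *)
Inductive tail_span (k : nat) : Cl -> Prop :=
| tail_span1 : tail_span k 1
| tail_spanP a x y : tail_span k x -> tail_span k y -> tail_span k (a *: x + y)
| tail_spanM (i : 'I_(p + q)) x : (k <= i)%N -> tail_span k x ->
    tail_span k (vec (e i) * x).

(** Moving e_i past each generator e_j with j > i costs a sign, which the sign of [alpha] on e_j
    compensates. *)
Lemma tail_span_twisted k (i : 'I_(p + q)) x : (i < k)%N -> tail_span k x ->
  alpha x * vec (e i) = vec (e i) * x.
Proof.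
move=> ik; elim=> [|a y z _ IHy _ IHz|j y kj _ IHy].
- by rewrite rmorph1 mul1r mulr1.
- by rewrite linearP mulrDl mulrDr -scalerAl -scalerAr IHy IHz.
- have ij : i != j by rewrite -val_eqE ltn_eqF // (leq_trans ik kj).
  by rewrite rmorphM /= alpha_vec -mulrA IHy !mulrA vec_anticomm // mulNr.
Qed.

Lemma tail_span0 x : tail_span 0 x.
Proof.
elim/clifford_ind: x => [|a x y|i x]; [exact: tail_span1|exact: tail_spanP|].
exact: tail_spanM.
Qed.

(** Each e_i can be moved to the front of a word up to sign, and e_i^2 is a scalar, so at most one
    e_i survives. *)
Lemma tail_span_split (i : 'I_(p + q)) x : tail_span i x ->
  exists a b, [/\ tail_span i.+1 a, tail_span i.+1 b & x = a + vec (e i) * b].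
Proof.
have P0 k : tail_span k 0.
  by rewrite -[0](addNr 1) -scaleN1r; apply: tail_spanP; apply: tail_span1.
elim=> [|c y z _ [a [b [Ha Hb ->]]] _ [a' [b' [Ha' Hb' ->]]]
       |j y ij _ [a [b [Ha Hb ->]]]].
- by exists 1, 0; split; rewrite ?mulr0 ?addr0 //; apply: tail_span1.
- exists (c *: a + a'), (c *: b + b').
  split; [exact: tail_spanP|exact: tail_spanP|].
  by rewrite scalerDr mulrDr -scalerAr addrACA.
- have [eij|neij] := eqVneq i j.
    rewrite -eij; exists (Phi (e i) *: b), a; split=> //.
      by rewrite -[_ *: b]addr0; apply: tail_spanP.
    by rewrite mulrDr mulrA clifford_vec_sqr mulr_algl addrC.
  have lij : (i < j)%N by rewrite ltn_neqAle val_eqE neij.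
  (* The second witness is - e_j b, spelled in the shape that [tail_spanP] produces. *)
  exists (vec (e j) * a), (- 1 *: (vec (e j) * b) + 0).
  split; [exact: tail_spanM|by apply: tail_spanP => //; exact: tail_spanM|].
  by rewrite addr0 scaleN1r; exact: (mulrD_anticomm _ _ (vec_anticomm neij)).
Qed.

(* In x = a + e_k b with a, b free of e_0, ..., e_k, the relation                 *)
(* alpha(x) e_k = e_k x reduces to - e_k e_k b = e_k e_k b, so b = 0 and x loses *)
(* e_k; after n steps only scalars are left.                                     *)
Lemma twisted_center x : (forall v, alpha x * vec v = vec v * x) ->
  exists c : R, x = c%:A.
Proof.
move=> xC; have H k : (k <= p + q)%N -> tail_span k x.
  elim: k => [_|k IHk ltk]; first exact: tail_span0.
  have [a [b [Ha Hb xE]]] := tail_span_split (i := Ordinal ltk) (IHk (ltnW ltk)).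
  have := xC (e (Ordinal ltk)).
  rewrite {1 2}xE rmorphD rmorphM /= alpha_vec mulrDl mulrDr -mulrA.
  rewrite !(tail_span_twisted (k := k.+1)) // => /addrI.
  rewrite mulNr !mulrA => /eqP; rewrite eq_sym -addr_eq0 -mulr2n.
  rewrite clifford_vec_sqr mulr_algl -bil_diag bil_delta !mxE eqxx mulr1n.
  rewrite -scaler_nat !scaler_eq0 pnatr_eq0 (negbTE (signature_neq0 _)) /=.
  by move=> /eqP b0; rewrite xE b0 mulr0 addr0.
elim: (H _ (leqnn _)) => [|a y z _ [c ->] _ [d ->]|i y].
- by exists 1; rewrite scale1r.
- by exists (a * c + d); rewrite scalerDl scalerA.
- by rewrite leqNgt ltn_ord.
Qed.

Lemma Pin_ker x : Pin R p q x -> rho x = 1%:M -> x = -1 \/ x = 1.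
Proof.
move=> [xG xN] x1; have [xU _] := xG.
have [v|c xE] := @twisted_center x.
  by rewrite -[in RHS](mul1mx v) -x1 rhoP // mulrVK.
have bxE : bar x = c%:A by rewrite xE /bar !linearZ /= rmorph1 reversal1.
have NE : spinor_norm x = (c ^+ 2)%:A.
  by rewrite /spinor_norm bxE xE -scalerAl mul1r scalerA.
have inj := fmorph_inj (in_alg Cl).
have c2 : c ^+ 2 = 1.
  case: xN; rewrite NE => cE; first by apply: inj; rewrite /= cE scale1r.
  have {}cE : c ^+ 2 = -1 by apply: inj; rewrite /= cE scaleN1r.
  by have := sqr_ge0 c; rewrite cE ler0N1.
by move/eqP: c2; rewrite sqrf_eq1 => /orP[] /eqP cE; rewrite xE cE
  ?scaleN1r ?scale1r; [right|left].
Qed.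

(** * Products of unit vectors *)

(* The boolean is the parity of the number of factors. *)
Inductive versor : bool -> Cl -> Prop :=
| versor1 : versor false 1
| versorM b v x : (Phi v = 1 \/ Phi v = -1) -> versor b x ->
    versor (~~ b) (vec v * x).

(** For a vector, [bar] is negation, so N(v) = - v^2 = - Phi(v). *)
Lemma Pin_vec v : (Phi v = 1 \/ Phi v = -1) -> Pin R p q (vec v).
Proof.
move=> v1; have v0 : Phi v != 0.
  by case: v1 => ->; rewrite ?oppr_eq0 oner_eq0.
have [vG _] := Gamma_vec v0; split=> //.
rewrite /spinor_norm /bar alpha_vec raddfN /= reversal_vec mulrN clifford_vec_sqr.
by case: v1 => ->; rewrite ?scale1r ?scaleN1r ?opprK; auto.
Qed.

(** Each vector factor contributes one sign -1 to [alpha] and one to the determinant. *)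
Lemma versorP b x : versor b x ->
  [/\ Pin R p q x, alpha x = (-1) ^+ b *: x & \det (rho x) = (-1) ^+ b].
Proof.
elim=> [|{}b v {}x v1 _ [xP xa xd]].
  by split; rewrite ?rmorph1 ?scale1r //; [exact: Pin1|case: Gamma1 => _ ->; rewrite det1].
have v0 : Phi v != 0 by case: v1 => ->; rewrite ?oppr_eq0 oner_eq0.
have [vG vE] := Gamma_vec v0; have [xG _] := xP.
split; first by apply: PinM => //; apply: Pin_vec.
  rewrite rmorphM /= alpha_vec xa -scalerAr mulNr scalerN -scaleNr.
  by case: b {xa xd}; rewrite ?expr0 ?expr1 ?opprK.
have [_ ->] := GammaM vG xG; rewrite vE det_mulmx det_reflection_mx // xd.
by case: b {xa xd}; rewrite ?expr0 ?expr1 ?mulrNN mulr1.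
Qed.

(** The twisted action ignores nonzero scalars, so v may be divided by the square root of
    |Phi(v)|. *)
Lemma reflection_vec_normalized v : Phi v != 0 -> exists u,
  (Phi u = 1 \/ Phi u = -1) /\ rho (vec u) = reflection_mx v.
Proof.
move=> v0; have [vG vE] := Gamma_vec v0.
pose c := (Num.sqrt `|Phi v|)^-1.
have c2 : c ^+ 2 = `|Phi v|^-1 by rewrite exprVn sqr_sqrtr.
have c0 : c != 0 by rewrite -sqrf_eq0 c2 invr_eq0 normr_eq0.
exists (c *: v); split; last by rewrite linearZ /= -vE; case: (GammaZ c0 vG).
rewrite PhiZ c2; have [vp|vn] := ltrP 0 (Phi v).
  by left; rewrite gtr0_norm // mulVf.
by right; rewrite ler0_norm // invrN mulNr mulVf.
Qed.

(** * Generation of O(p,q) by reflections *)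

Definition versor_image (A : 'M[R]_(p + q)) :=
  exists b x, versor b x /\ rho x = A.

(** Seen in the Clifford algebra: v^2 is a nonzero scalar, which acts trivially. *)
Lemma reflection_involutive v : Phi v != 0 ->
  reflection_mx v *m reflection_mx v = 1%:M.
Proof.
move=> v0; have [vG <-] := Gamma_vec v0; have [_ <-] := GammaM vG vG.
rewrite clifford_vec_sqr.
by have [] := Gamma1 => G1 <-; case: (GammaZ v0 G1).
Qed.

Lemma versor_image_reflection v A : Phi v != 0 ->
  versor_image (reflection_mx v *m A) -> versor_image A.
Proof.
move=> v0 [b [x [bx xA]]]; have [u [u1 uE]] := reflection_vec_normalized v0.
exists (~~ b), (vec u * x); split; first exact: versorM.
have [[uG _] [xG _]] : Pin R p q (vec u) /\ Pin R p q x.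
  by split; [exact: Pin_vec|case: (versorP bx)].
have [_ ->] := GammaM uG xG.
by rewrite uE xA mulmxA reflection_involutive // mul1mx.
Qed.

Lemma reflection_O v A : Phi v != 0 -> O_indef R p q A ->
  O_indef R p q (reflection_mx v *m A).
Proof.
move=> v0 OA w; have [vG <-] := Gamma_vec v0.
by rewrite -mulmxA (rho_O vG).
Qed.

Lemma reflection_fix v w : bil v w = 0 -> reflection_mx v *m w = w.
Proof. by move=> vw; rewrite reflection_mxE vw mulr0 mul0r scale0r subr0. Qed.

Lemma reflection_sub u w : Phi u = Phi w -> Phi (u - w) != 0 ->
  reflection_mx (u - w) *m w = u.
Proof.
move=> uw uw0; rewrite reflection_mxE.
have -> : 2 * bil (u - w) w = - Phi (u - w).
  by rewrite PhiD bilDl bilNr bilNl -(bil_diag (- w)) bilNr bilNl uw bil_diag; ring.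
by rewrite mulNr divff // scaleN1r opprK addrC subrK.
Qed.

(** The substitute for [reflection_sub] when u - w is isotropic; a further reflection in u removes
    the sign. *)
Lemma reflection_add u w : Phi u = Phi w -> Phi (u + w) != 0 ->
  reflection_mx (u + w) *m w = - u.
Proof.
move=> uw uw0; rewrite reflection_mxE.
have -> : 2 * bil (u + w) w = Phi (u + w).
  by rewrite PhiD bilDl uw bil_diag; ring.
by rewrite divff // scale1r opprD addrCA subrr addr0.
Qed.

(* Composing with at most two reflections makes an isometry fixing e_j for j > k *)
(* fix e_k as well, without disturbing the e_j, which are orthogonal to e_k and  *)
(* to its image.                                                                 *)
Lemma cartan_dieudonne A : O_indef R p q A -> versor_image A.
Proof.
(* Only basis vectors of index below [k] may be moved: no constraint at [k] = p + q, the identity at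
   [k] = 0. *)
suff H k : forall B, O_indef R p q B ->
    (forall j : 'I_(p + q), (k <= j)%N -> B *m e j = e j) -> versor_image B.
  by move=> OA; apply: (H (p + q)%N) => // j; rewrite leqNgt ltn_ord.
elim: k => [|k IHk] {}A OA Afix.
  exists false, 1; split; first exact: versor1.
  have [_ ->] := Gamma1; apply/matrixP => i j.
  have : A *m e j = 1%:M *m e j by rewrite mul1mx Afix.
  by rewrite -!colE => /colP/(_ i); rewrite !mxE.
have [ltk|gek] := ltnP k (p + q); last first.
  by apply: IHk => // j /(leq_trans gek); rewrite leqNgt ltn_ord.
pose u : V := e (Ordinal ltk); pose w := A *m u.
have uw : Phi u = Phi w by rewrite /w OA.
have orth (j : 'I_(p + q)) : (k < j)%N -> bil u (e j) = 0 /\ bil w (e j) = 0.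
  move=> kj; have u0 : bil u (e j) = 0.
    by rewrite bil_delta mxE -val_eqE /= ltn_eqF // mulr0n.
  by split=> //; rewrite -(Afix j kj) O_bil.
have u0 : Phi u != 0.
  by rewrite -bil_diag bil_delta mxE mxE eqxx mulr1n signature_neq0.
have fixk B : B *m w = u -> (forall j : 'I_(p + q), (k < j)%N -> B *m e j = e j) ->
    forall j : 'I_(p + q), (k <= j)%N -> B *m A *m e j = e j.
  move=> Bw Bfix j; rewrite -mulmxA leq_eqVlt => /orP[/eqP kj|kj].
    by have -> : j = Ordinal ltk by exact/val_inj.
  by rewrite Afix // Bfix.
have [uwm0|uwm0] := eqVneq (Phi (u - w)) 0; last first.
  apply: (versor_image_reflection uwm0); apply: IHk; first exact: reflection_O.
  apply: fixk => [|j /orth[uj wj]]; first exact: reflection_sub.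
  by apply: reflection_fix; rewrite bilDl bilNl uj wj subrr.
(* Phi (u - w) + Phi (u + w) = 4 Phi u, so the two vectors are not both isotropic. *)
have uwp0 : Phi (u + w) != 0.
  have -> : Phi (u + w) = 4 * Phi u - Phi (u - w).
    by rewrite !PhiD bilNr -(bil_diag (- w)) bilNr bilNl bil_diag uw; ring.
  by rewrite uwm0 subr0 mulf_neq0 ?pnatr_eq0.
apply: (versor_image_reflection uwp0); apply: (versor_image_reflection u0).
apply: IHk; first by do 2!apply: reflection_O => //.
rewrite mulmxA; apply: fixk => [|j /orth[uj wj]].
  rewrite -mulmxA reflection_add // reflection_mxE bilNr bil_diag mulrN mulNr.
  by rewrite mulfK // scaleNr opprK scaler_nat mulr2n addrA addNr add0r.
by rewrite -mulmxA !reflection_fix // bilDl uj wj addr0.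
Qed.

(** * Determinants on Pin and Spin *)

(** Some product y of unit vectors has the same image as x, so x y^-1 lies in the kernel and x is y
    or -y. *)
Lemma Pin_versor x : Pin R p q x -> exists2 b, versor b x \/ versor b (- x) &
  \det (rho x) = (-1) ^+ b.
Proof.
move=> xP; have [xG _] := xP; have [xU _] := xG.
have [b [y [by_ yx]]] := cartan_dieudonne (rho_O xG).
have [yP _ yd] := versorP by_; exists b; last by rewrite -yx.
have [yG _] := yP; have [yU _] := yG.
have yVG := GammaV yG; have [_ yV1] := GammaM yG yVG.
have : rho (x * y^-1) = 1%:M.
  have [_ ->] := GammaM xG yVG; rewrite -yx -yV1 mulrV //; by case: Gamma1.
case/(Pin_ker (PinM xP (PinV yP))) => xy; [right|left].
  by rewrite -[x](mulrVK yU) xy mulN1r opprK.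
by rewrite -[x](mulrVK yU) xy mul1r.
Qed.

(* An x both even and, up to sign, an odd product of vectors satisfies x = - x. *)
Lemma det_rho_Spin x : Spin R p q x -> \det (rho x) = 1.
Proof.
move=> [xP [_ xe]]; have [b bx ->] := Pin_versor xP.
have [[xU _] _] := xP.
have : x = (-1) ^+ b *: x.
  rewrite -{1}[x]xe; case: bx => /versorP[_]; first by [].
  by rewrite raddfN scalerN => /oppr_inj.
case: b {bx} => // /eqP; rewrite expr1 scaleN1r -addr_eq0 -mulr2n -scaler_nat.
rewrite scaler_eq0 pnatr_eq0 /= => /eqP x0.
by move: xU; rewrite x0 unitr0.
Qed.

Lemma signs_Pin x : x = -1 \/ x = 1 ->
  [/\ Pin R p q x, alpha x = x & rho x = 1%:M].
Proof.
have [G1 r1] := Gamma1.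
case=> ->; last by split; [exact: Pin1|rewrite rmorph1|].
split; [by apply: PinN; exact: Pin1|by rewrite rmorphN1|].
rewrite -scaleN1r -r1.
by case: (GammaZ (c := -1) _ G1); rewrite ?oppr_eq0 ?oner_eq0.
Qed.

End Pinor.

Theorem theorem1p13 (R : realType) (p q : nat) :
  [/\ group_hom (Pin R p q) (O_indef R p q) (@rho R p q),
      set_surj (Pin R p q) (O_indef R p q) (@rho R p q)
    & group_ker (Pin R p q) (@rho R p q) = [set -1; 1]] /\
  [/\ group_hom (Spin R p q) (SO_indef R p q) (@rho R p q),
      set_surj (Spin R p q) (SO_indef R p q) (@rho R p q)
    & group_ker (Spin R p q) (@rho R p q) = [set -1; 1]].
Proof.
split; split.
- split; [exact: Pin_group|exact: O_group|by move=> x [xG _]; exact: rho_O|].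
  by move=> x y [xG _] [yG _]; case: (GammaM xG yG).
- move=> A /cartan_dieudonne[b [x [bx <-]]].
  by exists x => //; case: (versorP bx).
- apply/seteqP; split=> x; first by case; exact: Pin_ker.
  by move/signs_Pin => [].
- split; [exact: Spin_group|exact: SO_group| |].
    by move=> x xS; split; [case: xS => _ [xG _]; exact: rho_O|exact: det_rho_Spin].
  by move=> x y [_ [xG _]] [_ [yG _]]; case: (GammaM xG yG).
- move=> A [/cartan_dieudonne[b [x [bx <-]]]].
  (* Determinant 1 reads (-1)^b = 1, which is also the sign by which [alpha] acts on x, so x is
     even. *)
  have [xP xa ->] := versorP bx => b1; exists x => //; split=> //.
  by split; [case: xP|rewrite /Cl0 /= xa b1 scale1r].
- apply/seteqP; split=> x; first by case=> -[xP _]; exact: Pin_ker.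
  by move/signs_Pin => [xP xe x1]; split=> //; split=> //; split=> //; case: xP.
Qed.
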